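(* Let $G$ be a connected graph of order $n$ with $m$ edges, maximum degree $\Delta$ and minimum degree $\delta$, such that its complement $\overline{G}$ is also connected, and let $k$ be an integer with $2\leq k\leq n$. Let $s_1=\max\{\Delta,\,n-\delta-1\}$ and $t_1=\min\{\delta,\,n-\Delta-1\}$. Then: (1) $\operatorname{SGut}_k(G)+\operatorname{SGut}_k(\overline{G})\leq (n-1)^2\binom{n}{k}s_1^{k-1}$ and $\operatorname{SGut}_k(G)\cdot \operatorname{SGut}_k(\overline{G})\leq 2m(n^2-n-2m)(n-1)^2\binom{n-1}{k-1}^2\frac{\Delta^{k-1}(n-\delta-1)^{k-1}}{k^2}$; moreover, these upper bounds are sharp. (2) $$\operatorname{SGut}_k(G)+\operatorname{SGut}_k(\overline{G})\geq\begin{cases}(n-1)(k-1)\binom{n}{k}t_1^{k-1} & \text{if } \delta\geq 2,\ \Delta\leq n-3,\\ 2m(k-1)\binom{n-1}{k-1}\frac{\delta^{k-1}}{k}+k\binom{n}{k} & \text{if } \delta\geq 2,\ \Delta=n-2,\\ k\binom{n}{k}+[n(n-1)-2m](k-1)\binom{n-1}{k-1}\frac{(n-\Delta-1)^{k-1}}{k} & \text{if } \delta=1,\ \Delta\leq n-3,\\ 2k\binom{n}{k} & \text{if } \delta=1,\ \Delta=n-2.\end{cases}$$ (3) $$\operatorname{SGut}_k(G)\cdot\operatorname{SGut}_k(\overline{G})\geq\begin{cases}2m(n^2-n-2m)(k-1)^2\binom{n-1}{k-1}^2\frac{\delta^{k-1}(n-\Delta-1)^{k-1}}{k^2} & \text{if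 } \delta\geq 2,\ \Delta\leq n-3,\\ 2m(k-1)\binom{n}{k}\binom{n-1}{k-1}\delta^{k-1} & \text{if } \delta\geq 2,\ \Delta=n-2,\\ [n(n-1)-2m](k-1)\binom{n}{k}\binom{n-1}{k-1}(n-\Delta-1)^{k-1} & \text{if } \delta=1,\ \Delta\leq n-3,\\ k^2\binom{n}{k}^2 & \text{if } \delta=1,\ \Delta=n-2.\end{cases}$$
   Context: All graphs are finite, simple and undirected; $\overline{G}$ is the complement of $G$. For a connected graph $G$ and $S\subseteq V(G)$ with $|S|\ge 2$, the Steiner distance $d_G(S)$ is the minimum number of edges of a connected subgraph of $G$ whose vertex set contains $S$. $\deg_G(v)$ is the degree of $v$. The Steiner Gutman $k$-index is $\operatorname{SGut}_k(G)=\sum_{S\subseteq V(G),\,|S|=k}\left(\prod_{v\in S}\deg_G(v)\right)d_G(S)$. ''Sharp'' means that equality is attained for some graph $G$ satisfying the hypotheses. *)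

(* Defs.v *)
From HB Require Import structures.
From mathcomp Require Import all_boot all_order all_algebra.

Set Implicit Arguments.
Unset Strict Implicit.
Unset Printing Implicit Defensive.

Record sgraph := SGraph {
  vertex :> finType;
  adj : rel vertex;
  adj_sym : symmetric adj;
  adj_irr : irreflexive adj }.

Arguments adj {G} : rename.

Section Graph.
Variable G : sgraph.
Implicit Types (x y v : G) (S W : {set G}) (F : {set {set G}}).

Definition compl_adj : rel G := fun x y => (x != y) && ~~ adj x y.

Lemma compl_adj_sym : symmetric compl_adj.
Proof. by move=> x y; rewrite /compl_adj eq_sym adj_sym. Qed.

Lemma compl_adj_irr : irreflexive compl_adj.
Proof. by move=> x; rewrite /compl_adj eqxx. Qed.

Definition compl : sgraph := SGraph compl_adj_sym compl_adj_irr.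

Definition edges : {set {set G}} :=
  [set [set p.1; p.2] | p : G * G in [set q : G * G | adj q.1 q.2]].

Definition deg v : nat := #|[set u | adj v u]|.

Definition max_degree : nat := \max_(v : G) deg v.

(* The default #|G| exceeds every degree, so it matters only if G is empty. *)
Definition min_degree : nat := \big[minn/#|G|]_(v : G) deg v.

Definition is_subgraph W F : bool :=
  (F \subset edges) && [forall E in F, E \subset W].

Definition connected_pair W F : bool :=
  (W != set0) &&
  [forall x in W, forall y in W, connect (fun u v => [set u; v] \in F) x y].

Definition connected : bool := connected_pair [set: G] edges.

Definition spans_connected S (H : {set G} * {set {set G}}) : bool :=
  [&& is_subgraph H.1 H.2, connected_pair H.1 H.2 & S \subset H.1].

(* If G is connected then G itself, the starting point of the arg min, is
   admissible; for a disconnected G the value may be meaningless. *)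
Definition steiner_dist S : nat :=
  #|([arg min_(H < ([set: G], edges) | spans_connected S H) #|H.2|]).2|.

Definition SGut (k : nat) : nat :=
  \sum_(S : {set G} | #|S| == k) (\prod_(v in S) deg v) * steiner_dist S.

End Graph.

Definition graph_params (G : sgraph) (n m Dmax dmin k : nat) : Prop :=
  [/\ connected G, connected (compl G) & 2 <= k <= n] /\
  [/\ #|G| = n, #|edges G| = m, max_degree G = Dmax & min_degree G = dmin].

(* Natural subtraction is harmless here: dmin <= Dmax <= n - 1. *)
Definition s1 (n Dmax dmin : nat) : nat := maxn Dmax (n - dmin - 1).
Definition t1 (n Dmax dmin : nat) : nat := minn dmin (n - Dmax - 1).

Import GRing.Theory.
Local Open Scope ring_scope.

Definition sum_upper (n Dmax dmin k : nat) : rat :=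
  (n%:R - 1) ^+ 2 * 'C(n, k)%:R * (s1 n Dmax dmin)%:R ^+ (k - 1).

Definition prod_upper (n m Dmax dmin k : nat) : rat :=
  2%:R * m%:R * (n%:R ^+ 2 - n%:R - 2%:R * m%:R) * (n%:R - 1) ^+ 2
  * 'C(n - 1, k - 1)%:R ^+ 2
  * (Dmax%:R ^+ (k - 1) * (n%:R - dmin%:R - 1) ^+ (k - 1) / k%:R ^+ 2).

(* Main.v *)
(** A subtree of a connected graph can be grown one vertex and one edge at a
    time until it exhausts the vertices, so |S| - 1 <= d(S) <= n - 1.
    For |S| = k, comparing each factor with an extreme degree gives
    d^(k-1) sum_(v in S) deg v <= k prod_(v in S) deg v <= D^(k-1) sum_(v in S) deg v,
    and summing over S replaces sum_(v in S) deg v by 'C(n-1, k-1) sum_v deg v.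
    Applied to G and its complement, whose degree sums are 2m and
    n(n-1) - 2m, this yields the bounds involving m.
    The bounds k 'C(n, k) hold termwise: if the degrees in S have a product at
    least 2, use 2(k-1) >= k; if all are 1 and d(S) = k - 1, then a minimal
    Steiner tree joins two adjacent leaves, so G is a single edge and its
    complement is disconnected.
    The pentagon with k = n = 5 attains both upper bounds. *)
Require Import Defs.
From mathcomp Require Import all_boot all_order all_algebra.
From mathcomp Require Import zify ring lra.

Set Implicit Arguments.
Unset Strict Implicit.
Unset Printing Implicit Defensive.

(** * Spanning trees of connected pairs *)

Section Trees.
Variable G : sgraph.
Implicit Types (x y u v : G) (S W : {set G}) (F : {set {set G}}).

(** The relation spelled out inside [connected_pair], named so that it can be handled by
    [connect]. *)
Definition edge_rel F : rel G := fun u v => [set u; v] \in F.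

Lemma connect_edge_sym F : connect_sym (edge_rel F).
Proof. by apply: sym_connect_sym => u v; rewrite /edge_rel setUC. Qed.

Lemma mem_edges x y : ([set x; y] \in edges G) = adj x y.
Proof.
apply/imsetP/idP => [[[a b]]|xy]; last by exists (x, y); rewrite ?inE.
rewrite inE /= => ab /setP eq_xy.
have := eq_xy x; have := eq_xy y; have := eq_xy b; have := eq_xy a.
rewrite !inE !eqxx !orbT /=.
move=> ha hb /esym/orP[]/eqP ey /esym/orP[]/eqP ex; subst => //.
- by move: hb; rewrite orbb => /eqP eb; rewrite eb in ab *.
- by rewrite adj_sym.
- by move: ha; rewrite orbb => /eqP eb; rewrite eb in ab *.
Qed.

Lemma connected_pair_root W F x0 :
    x0 \in W -> {in W, forall y, connect (edge_rel F) x0 y} ->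
  connected_pair W F.
Proof.
move=> x0W x0F; apply/andP; split; first by apply/set0Pn; exists x0.
apply/forall_inP => x xW; apply/forall_inP => y yW.
by apply: connect_trans (x0F y yW); rewrite connect_edge_sym x0F.
Qed.

(** If no edge of [F] left [W'], then [W'] would be closed under [edge_rel F] and could not miss a
    vertex of [W]. *)
Lemma connected_crossing W F x0 W' :
    connected_pair W F -> x0 \in W' -> W' \proper W ->
  exists u v, [/\ u \in W', v \notin W' & [set u; v] \in F].
Proof.
move=> /andP[_ /forall_inP conn] x0W' /properP[sW'W [y yW yW']].
case: (boolP [exists u in W', exists v, (v \notin W') && edge_rel F u v]).
  by move=> /exists_inP[u uW' /existsP[v /andP[vW' uv]]]; exists u, v.
move=> noX; case/negP: yW'.
have cl : closed (edge_rel F) (mem W').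
  apply: (intro_closed (connect_edge_sym F)) => u v uv uW'.
  apply: contraNT noX => vW'; apply/exists_inP; exists u => //.
  by apply/existsP; exists v; rewrite vW'.
rewrite -(closed_connect cl (x := x0)) //.
exact: (forall_inP (conn x0 (subsetP sW'W _ x0W'))).
Qed.

(** Induction on the number [j] of edges: while [W'] is proper in [W], a crossing edge adds exactly
    one vertex and one edge. Connectivity is kept relative to the root [x0], so each step only has
    to reach the new vertex. *)
Lemma subtree_of_size W F x0 j :
    connected_pair W F -> [forall E in F, E \subset W] ->
    x0 \in W -> j < #|W| ->
  exists W' F',
    [/\ x0 \in W', W' \subset W & #|W'| = j.+1] /\
    [/\ F' \subset F, #|F'| = j, [forall E in F', E \subset W']
      & {in W', forall y, connect (edge_rel F') x0 y}].
Proof.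
move=> cWF /forall_inP sFW x0W; elim: j => [|j IHj] jW.
  exists [set x0], set0; rewrite sub1set set11 cards1 sub0set cards0.
  split=> //; split=> //; first by apply/forall_inP => E; rewrite inE.
  by move=> y /set1P ->.
have {IHj} [W' [F' [[x0W' sW' cW'] [sF' cF' /forall_inP F'W' conn]]]] :=
  IHj (ltnW jW).
have prW' : W' \proper W by rewrite properEcard sW' cW'.
have [u [v [uW' vW' uvF]]] := connected_crossing cWF x0W' prW'.
(* Edges of [F'] stay inside [W'], so an edge ending at [v] is new and the count grows by exactly
   one. *)
have uvF' : [set u; v] \notin F'.
  apply: contra vW' => /F'W' /subsetP; apply; by rewrite !inE eqxx orbT.
have sconn : subrel (connect (edge_rel F'))
                    (connect (edge_rel ([set u; v] |: F'))).
  apply: connect_sub => a b ab; apply: connect1.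
  by rewrite /edge_rel inE orbC [_ \in F']ab.
exists (v |: W'), ([set u; v] |: F'); split; split.
- by rewrite inE x0W' orbT.
- rewrite subUset sW' andbT sub1set; apply: (subsetP (sFW _ uvF)).
  by rewrite !inE eqxx orbT.
- by rewrite cardsU1 vW' cW'.
- by rewrite subUset sF' sub1set uvF.
- by rewrite cardsU1 uvF' cF'.
- apply/forall_inP => E /setU1P[->|/F'W' sE].
    by apply/subsetP => z /set2P[]->; rewrite !inE ?eqxx ?uW' ?orbT.
  exact: subset_trans sE (subsetUr _ _).
- move=> y /setU1P[->|/conn /sconn //].
  apply: connect_trans (sconn _ _ (conn u uW')) _; apply: connect1.
  by rewrite /edge_rel !inE eqxx.
Qed.

(** A subtree with [#|W|.-1] edges has [#|W|] vertices, hence covers [W]. *)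
Lemma spanning_tree W F :
    connected_pair W F -> [forall E in F, E \subset W] ->
  exists F', [/\ F' \subset F, #|F'|.+1 = #|W| & connected_pair W F'].
Proof.
move=> cWF sFW; have /andP[/set0Pn[x0 x0W] _] := cWF.
have W_gt0 : 0 < #|W| by apply/card_gt0P; exists x0.
have ltW : #|W|.-1 < #|W| by rewrite prednK.
have [W' [F' [[_ sW' cW'] [sF' cF' _ conn]]]] :=
  subtree_of_size cWF sFW x0W ltW.
have eW : W' = W by apply/eqP; rewrite eqEcard sW' cW' prednK /=.
exists F'; rewrite cF' prednK // -eW; split=> //.
by apply: connected_pair_root conn; rewrite eW.
Qed.

(** * Bounds on the Steiner distance *)

Lemma spans_connected_full S : connected G -> spans_connected S ([set: G], edges G).
Proof.
move=> cG; apply/and3P; split; [|exact: cG|exact: subsetT].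
by rewrite /is_subgraph subxx; apply/forall_inP => E _; apply: subsetT.
Qed.

Lemma steiner_dist_le S : connected G -> steiner_dist S <= #|G|.-1.
Proof.
move=> cG; rewrite /steiner_dist; case: arg_minnP => [|H _ minH].
  exact: spans_connected_full.
have /and3P[/andP[_ sE] _ _] := spans_connected_full S cG.
(* A spanning tree of [G] competes in the minimum with [#|G|.-1] edges. *)
have [F [sF cF conn]] := spanning_tree cG sE.
move: cF; rewrite cardsT => <- /=; apply: (minH ([set: G], F)).
rewrite /spans_connected /is_subgraph sF conn subsetT !andbT /=.
by apply/forall_inP => E _; apply: subsetT.
Qed.

Lemma steiner_distP S : connected G ->
  exists2 H, spans_connected S H & steiner_dist S = #|H.2|.
Proof.
move=> cG; rewrite /steiner_dist; case: arg_minnP => [|H hH _].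
  exact: spans_connected_full.
by exists H.
Qed.

(** A spanning tree of [H] uses some of its edges, one fewer than its vertices. *)
Lemma spans_connected_card S H : spans_connected S H -> #|H.1| <= #|H.2|.+1.
Proof.
move=> /and3P[/andP[_ sE] conn _].
by have [F [/subset_leq_card sF <- _]] := spanning_tree conn sE; rewrite ltnS.
Qed.

Lemma steiner_dist_ge S : connected G -> #|S| <= (steiner_dist S).+1.
Proof.
move=> cG; have [H hH ->] := steiner_distP S cG.
apply: leq_trans (spans_connected_card hH).
by case/and3P: hH => _ _; apply: subset_leq_card.
Qed.

Lemma steiner_dist_setT : connected G -> steiner_dist [set: G] = #|G|.-1.
Proof.
move=> cG; apply/eqP; rewrite eqn_leq steiner_dist_le //=.
by have := steiner_dist_ge [set: G] cG; rewrite cardsT; case: #|G|.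
Qed.

(** * Reachability and degrees *)

Lemma connectedP :
  reflect (0 < #|G| /\ forall x y, connect (@adj G) x y) (connected G).
Proof.
have eqc x y : connect (edge_rel (edges G)) x y = connect (@adj G) x y.
  by apply: eq_connect => a b; apply: mem_edges.
apply: (iffP andP) => [[/set0Pn[x _] /forall_inP conn]|[/card_gt0P[x _] conn]].
  split=> [|a b]; first by apply/card_gt0P; exists x.
  by rewrite -eqc; apply: (forall_inP (conn a _)).
split; first by apply/set0Pn; exists x.
apply/forall_inP => a _; apply/forall_inP => b _.
by rewrite -[connect _ _ _]/(connect (edge_rel (edges G)) a b) eqc.
Qed.

(** Handshake lemma, by double counting the pairs of a vertex and an edge containing it. *)
Lemma sum_deg : \sum_(v : G) deg v = 2 * #|edges G|.
Proof.
have card_edge E : E \in edges G -> #|E| = 2.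
  case/imsetP => -[x y]; rewrite inE /= => xy ->; rewrite cards2.
  by case: eqP xy => // ->; rewrite adj_irr.
have star_inj v : {in [set u | adj v u] &, injective (fun u => [set v; u])}.
  move=> a b; rewrite !inE => va vb /setP /(_ a).
  by rewrite !inE eqxx orbT => /esym/orP[]/eqP // e; rewrite e adj_irr in va.
(* Sending a neighbour [u] to the edge joining it to [v] is a bijection onto the edges at [v]. *)
have degE v : deg v = \sum_(E in edges G | v \in E) 1.
  rewrite sum1_card /deg -(card_in_imset (@star_inj v)).
  apply: eq_card => E; apply/imsetP/andP => [[u]|[/imsetP[[x y]]]].
    by rewrite inE => vu ->; rewrite mem_edges vu !inE eqxx.
  rewrite inE /= => xy -> /set2P[] ->; first by exists y; rewrite ?inE.
  by exists x; rewrite ?inE 1?adj_sym // setUC.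
rewrite (eq_bigr _ (fun v _ => degE v)).
rewrite (exchange_big_dep (mem (edges G))) /=; last by move=> v E _ /andP[].
rewrite mulnC -sum_nat_const.
apply: eq_bigr => E eE; rewrite -(card_edge E eE) sum1_card.
by apply: eq_card => v; rewrite unfold_in /= eE.
Qed.

Lemma deg_compl v : @deg (compl G) v = #|G|.-1 - deg v.
Proof.
have -> : @deg (compl G) v = #|~: (v |: [set u | adj v u])|.
  by apply: eq_card => u; rewrite !inE /= /compl_adj negb_or eq_sym.
by rewrite cardsCs setCK cardsU1 inE adj_irr add1n; case: #|G| => // n; rewrite subSS.
Qed.

Lemma deg_lt v : deg v < #|G|.
Proof.
rewrite /deg; apply: (@leq_trans #|[set v] :|: [set u | adj v u]|).
  by rewrite cardsU1 inE adj_irr.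
exact: max_card.
Qed.

Lemma deg_max v : deg v <= max_degree G.
Proof. exact: (leq_bigmax_cond (F := @deg G)). Qed.

Lemma deg_min v : min_degree G <= deg v.
Proof.
(* [minn] has no neutral element on the naturals; the bound goes by induction on the enumeration. *)
rewrite /min_degree; have := mem_index_enum v.
elim: (index_enum _) => // u r IHr; rewrite inE big_cons geq_min.
by case/predU1P => [->|/IHr ->]; rewrite ?leqnn ?orbT.
Qed.

(** The first edge of a path from [v] to another vertex. *)
Lemma deg_gt0 v : connected G -> 1 < #|G| -> 0 < deg v.
Proof.
move=> /connectedP[_ conn] n_gt1.
have [w wv] : exists w, w != v.
  have : 0 < #|~: [set v]| by rewrite cardsCs setCK cards1; lia.
  by case/card_gt0P => w; rewrite !inE; exists w.
have /connectP[[|u p] /=] := conn v w; first by move=> _ e; rewrite e eqxx in wv.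
by move=> /andP[vu _] _; apply/card_gt0P; exists u; rewrite inE.
Qed.

End Trees.

(** * Bounds on the Steiner Gutman index in natural numbers *)

Section Gutman.
Variable (G : sgraph).
Implicit Types (v : G) (S : {set G}).

(** Pascal's rule: removing the [k]-subsets that avoid [v] from all [k]-subsets leaves those
    containing it. *)
Lemma card_draws_mem v k : 0 < k ->
  #|[set S : {set G} | (#|S| == k) && (v \in S)]| = 'C(#|G|.-1, k.-1).
Proof.
case: k => // k _.
have := card_draws G k.+1.
rewrite -(cardsID [set S : {set G} | v \in S]).
have -> : [set A : {set G} | #|A| == k.+1] :\: [set A : {set G} | v \in A]
   = [set A : {set G} | A \subset ~: [set v] & #|A| == k.+1].
  by apply/setP => A; rewrite !inE subsetC sub1set inE.
have -> : #|[set A : {set G} | A \subset ~: [set v] & #|A| == k.+1]| = 'C(#|G|.-1, k.+1).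
  by rewrite cards_draws [#|~: _|]cardsCs setCK cards1 subn1.
have -> : [set A : {set G} | #|A| == k.+1] :&: [set A : {set G} | v \in A]
   = [set A : {set G} | (#|A| == k.+1) && (v \in A)].
  by apply/setP => A; rewrite !inE.
have : 0 < #|G| by apply/card_gt0P; exists v.
by case: #|G| => // n _; rewrite binS /= addnC => /addnI.
Qed.

Lemma sum_draws (f : G -> nat) k : 0 < k ->
  \sum_(S : {set G} | #|S| == k) \sum_(v in S) f v
  = 'C(#|G|.-1, k.-1) * \sum_v f v.
Proof.
move=> k_gt0; rewrite (exchange_big_dep predT) //= big_distrr /=.
apply: eq_bigr => v _; rewrite sum_nat_const -(card_draws_mem v) //.
by congr (_ * _); apply: eq_card => S; rewrite !inE.
Qed.

(** Write the left side as one copy of the product for each [v] in [S]; in that copy keep [deg v]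
    and bound the other [#|S|.-1] factors by [D]. *)
Lemma prod_deg_le S D : (forall v : G, deg v <= D) ->
  #|S| * \prod_(v in S) deg v <= D ^ #|S|.-1 * \sum_(v in S) deg v.
Proof.
move=> degD; rewrite -sum_nat_const big_distrr /=; apply: leq_sum => v vS.
rewrite (big_setD1 v) //= mulnC leq_mul2r; apply/orP; right.
rewrite (cardsD1 v S) vS /= -prod_nat_const; exact: leq_prod.
Qed.

Lemma prod_deg_ge S d : (forall v : G, d <= deg v) ->
  d ^ #|S|.-1 * \sum_(v in S) deg v <= #|S| * \prod_(v in S) deg v.
Proof.
move=> degd; rewrite -sum_nat_const big_distrr /=; apply: leq_sum => v vS.
rewrite [X in _ <= X](big_setD1 v) //= mulnC leq_mul2l; apply/orP; right.
rewrite (cardsD1 v S) vS /= -prod_nat_const; exact: leq_prod.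
Qed.

Hypothesis cG : connected G.

(** Multiplied by [k] to stay in the naturals, and stated with the degree sum so that it serves both
    the graph and its complement. *)
Lemma SGut_le k D : 0 < k -> (forall v : G, deg v <= D) ->
  k * SGut G k <=
  D ^ k.-1 * ('C(#|G|.-1, k.-1) * \sum_(v : G) deg v) * #|G|.-1.
Proof.
move=> k_gt0 degD; rewrite -sum_draws // /SGut !big_distrr /= big_distrl /=.
apply: leq_sum => S /eqP cS; rewrite mulnA leq_mul ?steiner_dist_le //.
by rewrite -cS prod_deg_le.
Qed.

Lemma SGut_ge k d : 0 < k -> (forall v : G, d <= deg v) ->
  d ^ k.-1 * ('C(#|G|.-1, k.-1) * \sum_(v : G) deg v) * k.-1 <= k * SGut G k.
Proof.
move=> k_gt0 degd; rewrite -sum_draws // /SGut !big_distrr /= big_distrl /=.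
apply: leq_sum => S /eqP cS; rewrite [leqRHS]mulnA leq_mul //.
  by rewrite -cS prod_deg_ge.
by have := steiner_dist_ge S cG; rewrite cS; lia.
Qed.

Lemma SGut_full : SGut G #|G| = (\prod_(v : G) deg v) * #|G|.-1.
Proof.
rewrite /SGut (big_pred1 [set: G]) => [|S]; last first.
  by rewrite /= eqEcard subsetT cardsT /= eqn_leq max_card.
by rewrite steiner_dist_setT //; congr (_ * _); apply: eq_bigl => v; rewrite inE.
Qed.

(* A connected graph containing two adjacent vertices of degree 1 is an edge,
   and then its complement is disconnected. *)
Lemma no_adjacent_leaves x y : connected (compl G) ->
  @adj G x y -> @deg G x = 1 -> @deg G y = 1 -> False.
Proof.
move=> /connectedP[_ cC] xy dx dy; have /connectedP[_ conn] := cG.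
have leaf (a b u : G) : adj a b -> deg a = 1 -> adj a u -> u = b.
  move=> ab /eqP/cards1P[c /setP ec] au.
  have := ec u; have := ec b; rewrite !inE ab au.
  by move=> /esym/eqP -> /esym/eqP ->.
have yx : @adj G y x by rewrite adj_sym.
have cl : closed (@adj G) (mem [set x; y]).
  apply: intro_closed; first exact/sym_connect_sym/adj_sym.
  move=> a b ab /set2P[] e; rewrite e in ab; rewrite !inE.
    by rewrite (leaf _ _ _ xy dx ab) eqxx orbT.
  by rewrite (leaf _ _ _ yx dy ab) eqxx.
have allxy z : z \in [set x; y] by rewrite -(closed_connect cl (conn x z)) !inE eqxx.
(* A path from [x] to [y] in the complement starts at some [u] distinct from and not adjacent to
   [x], but only [x] and [y] exist. *)
have /connectP[[|u p] /=] := cC x y.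
  by move=> _ e; rewrite -e adj_irr in xy.
move=> /andP[/andP[ux nxu] _] _; have := allxy u; rewrite !inE => /orP[]/eqP e.
  by rewrite e eqxx in ux.
by rewrite e xy in nxu.
Qed.

Lemma SGut_ge_binom k : connected (compl G) -> 1 < k <= #|G| ->
  k * 'C(#|G|, k) <= SGut G k.
Proof.
move=> cC /andP[k_gt1 k_le]; rewrite mulnC -(card_draws G) -sum1_card big_distrl /=.
rewrite /SGut (eq_bigl (fun S : {set G} => #|S| == k)) => [|S]; last by rewrite inE.
apply: leq_sum => S /eqP cS; rewrite mul1n.
have degp v : 0 < deg v by apply: deg_gt0 => //; lia.
have prod_gt0 : 0 < \prod_(v in S) deg v by apply: prodn_gt0.
have := steiner_dist_ge S cG; rewrite cS => dS.
(* If the product is at least 2, the term is at least [2 * (k - 1)], hence at least [k]. *)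
have [prod1|prod_gt1] : \prod_(v in S) deg v = 1 \/ 1 < \prod_(v in S) deg v by lia.
  2: by nia.
rewrite prod1 mul1n; case: (ltnP (steiner_dist S) k) => // lt_dS.
have [H hH dH] := steiner_distP S cG.
have cH := spans_connected_card hH.
have /and3P[/andP[sE sW] conn sS] := hH.
(* With fewer than [k] edges, [H] has at most [k] vertices, so none outside [S]; an edge leaving [x]
   then joins two leaves. *)
have eS : H.1 = S by apply/esym/eqP; rewrite eqEcard sS /=; lia.
have deg1 v : v \in S -> deg v = 1.
  move=> vS; apply/eqP; rewrite -dvdn1 -prod1 (big_setD1 v) //=; exact: dvdn_mulr.
have : 1 < #|S| by rewrite cS.
case/card_gt1P => x [y [xS yS xy]].
have prS : [set x] \proper H.1.
  by rewrite eS properEcard sub1set xS cards1 cS.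
have [u [v [/set1P -> _ xvF]]] := connected_crossing conn (set11 x) prS.
have vS : v \in S.
  rewrite -eS; apply: (subsetP (forall_inP sW _ xvF)).
  by rewrite !inE eqxx orbT.
have xv : adj x v by rewrite -mem_edges (subsetP sE).
by case: (no_adjacent_leaves cC xv (deg1 x xS) (deg1 v vS)).
Qed.

End Gutman.

(** * Transfer to rationals and combination of the bounds *)

Section RationalBounds.
Import Order.TTheory GRing.Theory Num.Theory.
Local Open Scope ring_scope.

Lemma eq_ler (x y : rat) : x = y -> x <= y.
Proof. by move=> ->. Qed.

Lemma natrB_pred (n i : nat) : (i < n)%N ->
  n%:R - i%:R - 1 = (n - i - 1)%:R :> rat.
Proof. by move=> i_n; rewrite natrB ?subn_gt0 // natrB // ltnW. Qed.

(** At each vertex the degrees in [G] and in its complement add up to [#|G|.-1]. *)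
Lemma sum_deg_compl (G : sgraph) : (0 < #|G|)%N ->
  (\sum_(v : compl G) deg v)%:R =
    #|G|%:R * (#|G|%:R - 1) - 2 * #|edges G|%:R :> rat.
Proof.
move=> n_gt0; have -> : 2 * #|edges G|%:R = (\sum_(v : G) deg v)%:R :> rat.
  by rewrite sum_deg natrM.
suff -> : (#|G|%:R * (#|G|%:R - 1) : rat)
  = ((\sum_(v : compl G) deg v) + \sum_(v : G) deg v)%:R by rewrite natrD addrK.
rewrite -big_split /= (eq_bigr (fun=> #|G|.-1)) => [|v _].
  by rewrite sum_nat_const natrM; congr (_ * _); rewrite -subn1 natrB.
by rewrite deg_compl subnK //; have := deg_lt v; case: #|G|.
Qed.

Lemma SGut_le_rat (G : sgraph) (k D : nat) :
    connected G -> (0 < k)%N -> (0 < #|G|)%N -> (forall v : G, (deg v <= D)%N) ->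
  (SGut G k)%:R <= D%:R ^+ (k - 1)
    * ('C(#|G| - 1, k - 1)%:R * (\sum_(v : G) deg v)%:R) * (#|G|%:R - 1) / k%:R :> rat.
Proof.
move=> cG k_gt0 n_gt0 degD; rewrite ler_pdivlMr ?ltr0n // mulrC -natrM.
rewrite -[#|G|%:R - 1](natrB _ n_gt0) -natrX -!natrM ler_nat !subn1.
exact: SGut_le.
Qed.

Lemma SGut_ge_rat (G : sgraph) (k d : nat) :
    connected G -> (0 < k)%N -> (forall v : G, (d <= deg v)%N) ->
  d%:R ^+ (k - 1) * ('C(#|G| - 1, k - 1)%:R * (\sum_(v : G) deg v)%:R)
    * (k%:R - 1) / k%:R <= (SGut G k)%:R :> rat.
Proof.
move=> cG k_gt0 degd; rewrite ler_pdivrMr ?ltr0n // [_ * k%:R]mulrC -natrM.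
rewrite -[k%:R - 1](natrB _ k_gt0) -natrX -!natrM ler_nat !subn1.
exact: SGut_ge.
Qed.

Section Bounds.
Variables (G : sgraph) (n m Dmax dmin k : nat).
Hypothesis params : graph_params G n m Dmax dmin k.

Let A : rat := (SGut G k)%:R.
Let B : rat := (SGut (compl G) k)%:R.
Let nQ : rat := n%:R.
Let mQ : rat := m%:R.
Let kQ : rat := k%:R.
Let DQ : rat := Dmax%:R.
Let dQ : rat := dmin%:R.
Let Cnk : rat := 'C(n, k)%:R.
Let Cnk1 : rat := 'C(n - 1, k - 1)%:R.
(** [MQ] and [McQ] are the degree sums of [G] and its complement; they add up to [nQ * (nQ - 1)]. *)
Let MQ : rat := 2 * mQ.
Let McQ : rat := nQ * (nQ - 1) - 2 * mQ.

Lemma params_arith : [/\ 0 < kQ, 1 <= kQ, 1 <= nQ, 0 <= Cnk1 & Cnk = nQ * Cnk1 / kQ].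
Proof.
case: params => -[_ _ /andP[k2 kn]] _; split; rewrite ?ltr0n ?ler1n //; try lia.
have k_neq0 : kQ != 0 by rewrite pnatr_eq0; lia.
apply: (canRL (mulfK k_neq0)); rewrite /Cnk /kQ -!natrM; congr _%:R.
by rewrite !subn1 mul_bin_diag prednK 1?mulnC //; lia.
Qed.

Lemma degree_bounds : [/\ (0 < dmin)%N, (dmin <= Dmax)%N & (Dmax < n)%N].
Proof.
case: params => -[cG cC /andP[k2 kn]] [nE mE DE dE]; split.
(* The default value [#|G|] of the minimum is positive too. *)
- rewrite -dE; apply: (big_ind (fun d => 0 < d)%N) => [|i j i0 j0|v _]; first lia.
    by rewrite leq_min i0.
  by apply: deg_gt0 => //; lia.
- have /card_gt0P[v _] : (0 < #|G|)%N by lia.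
  by rewrite -dE -DE (leq_trans (deg_min v)) // deg_max.
- rewrite -DE -nE -[#|G|]prednK; last lia.
  rewrite ltnS; apply/bigmax_leqP => v _; rewrite -ltnS prednK ?deg_lt //; lia.
Qed.

Lemma degree_bounds_rat :
  [/\ 1 <= dQ, dQ <= DQ, DQ <= nQ - 1, 0 <= MQ & 0 <= McQ].
Proof.
have [d_gt0 dD Dn] := degree_bounds.
case: params => -[_ _ /andP[k2 kn]] [nE mE _ _].
split; rewrite ?ler1n ?ler_nat ?mulr_ge0 ?ler0n //.
  by rewrite lerBrDr /DQ natr1 ler_nat.
by rewrite /McQ /nQ /mQ -nE -mE -sum_deg_compl ?ler0n //; lia.
Qed.

(** Degrees in the complement lie between [n - Dmax - 1] and [n - dmin - 1]. *)
Lemma SGut_bounds :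
  [/\ A <= DQ ^+ (k - 1) * (Cnk1 * MQ) * (nQ - 1) / kQ,
      B <= (nQ - dQ - 1) ^+ (k - 1) * (Cnk1 * McQ) * (nQ - 1) / kQ,
      dQ ^+ (k - 1) * (Cnk1 * MQ) * (kQ - 1) / kQ <= A
    & (nQ - DQ - 1) ^+ (k - 1) * (Cnk1 * McQ) * (kQ - 1) / kQ <= B].
Proof.
have [d_gt0 dD Dn] := degree_bounds.
case: params => -[cG cC /andP[k2 kn]] [nE mE DE dE].
have n_gt0 : (0 < #|G|)%N by lia.
have k_gt0 : (0 < k)%N by lia.
have ME : MQ = (\sum_(v : G) deg v)%:R by rewrite sum_deg natrM mE.
have McE : McQ = (\sum_(v : compl G) deg v)%:R by rewrite sum_deg_compl // nE mE.
rewrite !natrB_pred; try lia.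
rewrite ME McE /Cnk1 /nQ -nE; split.
- by apply: SGut_le_rat => // v; rewrite -DE deg_max.
- apply: (@SGut_le_rat (compl G)) => // v.
  by rewrite deg_compl -dE; have := @deg_min G v; lia.
- by apply: SGut_ge_rat => // v; rewrite -dE deg_min.
- apply: (@SGut_ge_rat (compl G)) => // v.
  by rewrite deg_compl -DE; have := @deg_max G v; lia.
Qed.

Lemma SGut_binom_bounds : kQ * Cnk <= A /\ kQ * Cnk <= B.
Proof.
case: params => -[cG cC kn] [nE _ _ _]; rewrite -nE in kn.
rewrite /kQ /Cnk -nE -natrM !ler_nat; split; first exact: SGut_ge_binom.
apply: (@SGut_ge_binom (compl G)) => //.
(* For [compl G] the complement to be shown connected is the double complement, whose adjacency
   agrees with that of [G] pointwise. *)
apply/connectedP; have /connectedP[G_gt0 conn] := cG; split=> //.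
move=> u v; rewrite (eq_connect (e' := @adj G)) => [|a b]; first exact: conn.
by rewrite /= /compl_adj /= /compl_adj; case: eqVneq => [->|]; rewrite ?adj_irr //= negbK.
Qed.

Lemma max_degree_s1 :
  DQ <= (s1 n Dmax dmin)%:R /\ nQ - dQ - 1 <= (s1 n Dmax dmin)%:R.
Proof.
have [_ dD Dn] := degree_bounds; rewrite /s1 ler_nat leq_maxl.
by rewrite natrB_pred ?ler_nat ?leq_maxr // (leq_ltn_trans dD).
Qed.

Lemma min_degree_t1 :
  (t1 n Dmax dmin)%:R <= dQ /\ (t1 n Dmax dmin)%:R <= nQ - DQ - 1.
Proof.
have [_ dD Dn] := degree_bounds; rewrite /t1 ler_nat geq_minl.
by rewrite natrB_pred // ler_nat geq_minr.
Qed.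

Lemma upper_bounds :
  A + B <= sum_upper n Dmax dmin k /\ A * B <= prod_upper n m Dmax dmin k.
Proof.
have [k_gt0 _ n_ge1 C_ge0 CE] := params_arith.
have [d_ge1 dD Dn M_ge0 Mc_ge0] := degree_bounds_rat.
have [AU BU _ _] := SGut_bounds; have [sD sd] := max_degree_s1.
have k_neq0 : kQ != 0 by rewrite gt_eqF.
have n1_ge0 : 0 <= nQ - 1 by lra.
have DX : DQ ^+ (k - 1) <= (s1 n Dmax dmin)%:R ^+ (k - 1).
  by apply: lerXn2r; rewrite ?nnegrE //; lra.
have dX : (nQ - dQ - 1) ^+ (k - 1) <= (s1 n Dmax dmin)%:R ^+ (k - 1).
  by apply: lerXn2r; rewrite ?nnegrE //; lra.
split.
  rewrite /sum_upper -/nQ -/Cnk CE; apply: le_trans (lerD AU BU) _.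
  set s := _%:R ^+ _ in DX dX *.
  (* With the common factor [s] the two bounds add up, by [MQ + McQ = nQ * (nQ - 1)] and the
     absorption identity for [Cnk]. *)
  have -> : (nQ - 1) ^+ 2 * (nQ * Cnk1 / kQ) * s =
    s * (Cnk1 * MQ) * (nQ - 1) / kQ + s * (Cnk1 * McQ) * (nQ - 1) / kQ.
    by rewrite /MQ /McQ; field.
  by rewrite lerD // !ler_wpM2r ?invr_ge0 ?(ltW k_gt0) ?mulr_ge0.
apply: le_trans (ler_pM _ _ AU BU) _; rewrite ?ler0n //.
rewrite /prod_upper -/nQ -/mQ -/kQ -/DQ -/dQ -/Cnk1 /MQ /McQ.
by apply: eq_ler; field.
Qed.

(** Each graph has a degree bound and a binomial bound; the four inequalities are the four ways to
    pair them. *)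
Lemma sum_lower_bounds :
  [/\ A + B >= (nQ - 1) * (kQ - 1) * Cnk * (t1 n Dmax dmin)%:R ^+ (k - 1),
      A + B >= 2 * mQ * (kQ - 1) * Cnk1 * (dQ ^+ (k - 1) / kQ) + kQ * Cnk,
      A + B >= kQ * Cnk + (nQ * (nQ - 1) - 2 * mQ) * (kQ - 1) * Cnk1
                          * ((nQ - DQ - 1) ^+ (k - 1) / kQ)
    & A + B >= 2 * kQ * Cnk].
Proof.
have [k_gt0 k_ge1 n_ge1 C_ge0 CE] := params_arith.
have [d_ge1 dD Dn M_ge0 Mc_ge0] := degree_bounds_rat.
have [_ _ AL BL] := SGut_bounds; have [td tD] := min_degree_t1.
have [AC BC] := SGut_binom_bounds.
have k_neq0 : kQ != 0 by rewrite gt_eqF.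
have k1_ge0 : 0 <= kQ - 1 by lra.
have dX : (t1 n Dmax dmin)%:R ^+ (k - 1) <= dQ ^+ (k - 1).
  by apply: lerXn2r; rewrite ?nnegrE //; lra.
have DX : (t1 n Dmax dmin)%:R ^+ (k - 1) <= (nQ - DQ - 1) ^+ (k - 1).
  by apply: lerXn2r; rewrite ?nnegrE //; lra.
split.
- rewrite CE; apply: le_trans (lerD AL BL).
  set t := _%:R ^+ _ in DX dX *.
  have -> : (nQ - 1) * (kQ - 1) * (nQ * Cnk1 / kQ) * t =
    t * (Cnk1 * MQ) * (kQ - 1) / kQ + t * (Cnk1 * McQ) * (kQ - 1) / kQ.
    by rewrite /MQ /McQ; field.
  by rewrite lerD // !ler_wpM2r ?invr_ge0 ?(ltW k_gt0) ?mulr_ge0.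
- by rewrite lerD //; apply: le_trans AL; apply: eq_ler; rewrite /MQ; field.
- by rewrite lerD //; apply: le_trans BL; apply: eq_ler; rewrite /McQ; field.
- by rewrite -mulrA mulr_natl mulr2n lerD.
Qed.

Lemma prod_lower_bounds :
  [/\ A * B >= 2 * mQ * (nQ ^+ 2 - nQ - 2 * mQ) * (kQ - 1) ^+ 2 * Cnk1 ^+ 2
               * (dQ ^+ (k - 1) * (nQ - DQ - 1) ^+ (k - 1) / kQ ^+ 2),
      A * B >= 2 * mQ * (kQ - 1) * Cnk * Cnk1 * dQ ^+ (k - 1),
      A * B >= (nQ * (nQ - 1) - 2 * mQ) * (kQ - 1) * Cnk * Cnk1
               * (nQ - DQ - 1) ^+ (k - 1)
    & A * B >= kQ ^+ 2 * Cnk ^+ 2].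
Proof.
have [k_gt0 k_ge1 n_ge1 C_ge0 CE] := params_arith.
have [d_ge1 dD Dn M_ge0 Mc_ge0] := degree_bounds_rat.
have [_ _ AL BL] := SGut_bounds; have [AC BC] := SGut_binom_bounds.
have k_neq0 : kQ != 0 by rewrite gt_eqF.
have k1_ge0 : 0 <= kQ - 1 by lra.
(* Multiplying lower bounds requires them to be nonnegative. *)
have AL_ge0 : 0 <= dQ ^+ (k - 1) * (Cnk1 * MQ) * (kQ - 1) / kQ.
  by rewrite !mulr_ge0 ?invr_ge0 ?exprn_ge0 ?(ltW k_gt0) //; lra.
have BL_ge0 : 0 <= (nQ - DQ - 1) ^+ (k - 1) * (Cnk1 * McQ) * (kQ - 1) / kQ.
  by rewrite !mulr_ge0 ?invr_ge0 ?exprn_ge0 ?(ltW k_gt0) //; lra.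
have C_bin_ge0 : 0 <= kQ * Cnk by rewrite mulr_ge0 ?ler0n.
split.
- apply: le_trans (ler_pM AL_ge0 BL_ge0 AL BL).
  by apply: eq_ler; rewrite /MQ /McQ; field.
- apply: le_trans (ler_pM AL_ge0 C_bin_ge0 AL BC).
  by apply: eq_ler; rewrite /MQ; field.
- apply: le_trans (ler_pM C_bin_ge0 BL_ge0 AC BL).
  by apply: eq_ler; rewrite /McQ; field.
- by rewrite -exprMn; apply: ler_pM.
Qed.

End Bounds.
End RationalBounds.

(** * The pentagon as extremal graph *)

Section Pentagon.

Definition pentagon_adj : rel 'I_5 :=
  fun i j => (j == i.+1 %% 5 :> nat) || (i == j.+1 %% 5 :> nat).

Lemma pentagon_sym : symmetric pentagon_adj.
Proof. by move=> i j; rewrite /pentagon_adj orbC. Qed.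

Lemma pentagon_irr : irreflexive pentagon_adj.
Proof. by case=> [[|[|[|[|[|]]]]]]. Qed.

Definition pentagon : sgraph := SGraph pentagon_sym pentagon_irr.

Lemma deg_pentagon (v : pentagon) : deg v = 2.
Proof.
rewrite /deg -sum1_card big_mkcond /= !big_ord_recl big_ord0 !inE /=.
by case: v => [[|[|[|[|[|]]]]]].
Qed.

Lemma deg_compl_pentagon (v : compl pentagon) : deg v = 2.
Proof. by rewrite deg_compl card_ord deg_pentagon. Qed.

(* The pentagon is the cycle i, i + s, i + 2 s, ... modulo 5 for s = 1, and its
   complement, the pentagram, is the one for s = 2. *)
Lemma connect_mod5_step (e : rel 'I_5) s : coprime s 5 ->
  (forall i j : 'I_5, j = (i + s) %% 5 :> nat -> e i j) ->
  forall i j, connect e i j.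
Proof.
move=> co_s estep i j.
have walk t : connect e i (inord ((i + t * s) %% 5)).
  elim: t => [|t IHt]; first by rewrite addn0 modn_small // inord_val.
  apply: connect_trans IHt _; apply/connect1/estep.
  by rewrite !inordK ?ltn_pmod // modnDml mulSn -addnA [t * s + s]addnC.
(* The number [u] of steps solves [u * s = j - i] modulo 5: the Chinese remainder theorem gives a
   multiple of [s] in the right class. Writing [5 - i] avoids truncation. *)
have [u ue] : exists u, u * s = j + (5 - i) %[mod 5].
  exists (chinese s 5 0 (j + (5 - i)) %/ s).
  by rewrite divnK ?chinese_modr // /dvdn chinese_modl // mod0n.
rewrite -[j](inord_val j) -(modn_small (ltn_ord j)).
have -> : j %% 5 = (i + u * s) %% 5; last exact: walk.
by rewrite -modnDmr ue modnDmr addnCA subnKC ?modnDr // ltnW.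
Qed.

Lemma connected_pentagon : connected pentagon.
Proof.
apply/connectedP; split; first by rewrite card_ord.
apply: (@connect_mod5_step _ 1) => // i j ij.
by rewrite /= /pentagon_adj ij addn1 eqxx.
Qed.

Lemma connected_compl_pentagon : connected (compl pentagon).
Proof.
apply/connectedP; split; first by rewrite card_ord.
apply: (@connect_mod5_step _ 2) => //.
by case=> [[|[|[|[|[|]]]]] ?] // [[|[|[|[|[|]]]]] ?].
Qed.

Lemma pentagon_params : graph_params pentagon 5 5 2 2 5.
Proof.
split; split; rewrite ?card_ord //.
- exact: connected_pentagon.
- exact: connected_compl_pentagon.
- have := sum_deg pentagon.
  rewrite (eq_bigr (fun=> 2)) => [|v _]; last exact: deg_pentagon.
  by rewrite sum_nat_const card_ord; lia.
- rewrite /max_degree (eq_bigr (fun=> 2)) => [|v _]; last exact: deg_pentagon.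
  by rewrite /= !big_ord_recl big_ord0.
- rewrite /min_degree (eq_bigr (fun=> 2)) => [|v _]; last exact: deg_pentagon.
  by rewrite /= !big_ord_recl big_ord0 card_ord.
Qed.

(** The only 5-subset is the whole vertex set, giving [2 ^ 5 * 4]. *)
Lemma SGut_pentagon : SGut pentagon 5 = 128.
Proof.
have := SGut_full connected_pentagon; rewrite card_ord => ->.
rewrite (eq_bigr (fun=> 2)) => [|v _]; last exact: deg_pentagon.
by rewrite prod_nat_const card_ord.
Qed.

Lemma SGut_compl_pentagon : SGut (compl pentagon) 5 = 128.
Proof.
have := SGut_full connected_compl_pentagon; rewrite card_ord => ->.
rewrite (eq_bigr (fun=> 2)) => [|v _]; last exact: deg_compl_pentagon.
by rewrite prod_nat_const card_ord.
Qed.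

End Pentagon.

(** * Assembly of the bounds and sharpness *)

Local Open Scope ring_scope.

Theorem theorem3p1 :
  (forall (G : sgraph) (n m Dmax dmin k : nat),
    graph_params G n m Dmax dmin k ->
    let A : rat := (SGut G k)%:R in
    let B : rat := (SGut (compl G) k)%:R in
    let nQ : rat := n%:R in
    let mQ : rat := m%:R in
    let kQ : rat := k%:R in
    let DQ : rat := Dmax%:R in
    let dQ : rat := dmin%:R in
    let Cnk : rat := 'C(n, k)%:R in
    let Cnk1 : rat := 'C(n - 1, k - 1)%:R in
    [/\ (A + B <= sum_upper n Dmax dmin k
         /\ A * B <= prod_upper n m Dmax dmin k),
        [/\ (2 <= dmin)%N -> (Dmax + 3 <= n)%N ->
              A + B >= (nQ - 1) * (kQ - 1) * Cnk
                       * (t1 n Dmax dmin)%:R ^+ (k - 1),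
            (2 <= dmin)%N -> (Dmax + 2 = n)%N ->
              A + B >= 2 * mQ * (kQ - 1) * Cnk1 * (dQ ^+ (k - 1) / kQ)
                       + kQ * Cnk,
            dmin = 1%N -> (Dmax + 3 <= n)%N ->
              A + B >= kQ * Cnk
                       + (nQ * (nQ - 1) - 2 * mQ) * (kQ - 1) * Cnk1
                         * ((nQ - DQ - 1) ^+ (k - 1) / kQ)
          & dmin = 1%N -> (Dmax + 2 = n)%N ->
              A + B >= 2 * kQ * Cnk]
      & [/\ (2 <= dmin)%N -> (Dmax + 3 <= n)%N ->
              A * B >= 2 * mQ * (nQ ^+ 2 - nQ - 2 * mQ) * (kQ - 1) ^+ 2
                       * Cnk1 ^+ 2
                       * (dQ ^+ (k - 1) * (nQ - DQ - 1) ^+ (k - 1) / kQ ^+ 2),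
            (2 <= dmin)%N -> (Dmax + 2 = n)%N ->
              A * B >= 2 * mQ * (kQ - 1) * Cnk * Cnk1 * dQ ^+ (k - 1),
            dmin = 1%N -> (Dmax + 3 <= n)%N ->
              A * B >= (nQ * (nQ - 1) - 2 * mQ) * (kQ - 1) * Cnk * Cnk1
                       * (nQ - DQ - 1) ^+ (k - 1)
          & dmin = 1%N -> (Dmax + 2 = n)%N ->
              A * B >= kQ ^+ 2 * Cnk ^+ 2]])
  /\ (exists (G : sgraph) (n m Dmax dmin k : nat),
        graph_params G n m Dmax dmin k
        /\ (SGut G k)%:R + (SGut (compl G) k)%:R = sum_upper n Dmax dmin k)
  /\ (exists (G : sgraph) (n m Dmax dmin k : nat),
        graph_params G n m Dmax dmin k
        /\ (SGut G k)%:R * (SGut (compl G) k)%:R = prod_upper n m Dmax dmin k).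
Proof.
split; [|split].
- move=> G n m Dmax dmin k params.
  have [L1 L2 L3 L4] := sum_lower_bounds params.
  have [P1 P2 P3 P4] := prod_lower_bounds params.
  by split; [exact: upper_bounds params|split|split].
(* Both graphs are 2-regular and [k = n], so the degree and distance estimates are equalities:
   [128 + 128 = 4 ^ 2 * 2 ^ 4]. *)
- exists pentagon, 5%N, 5%N, 2%N, 2%N, 5%N; split; first exact: pentagon_params.
  rewrite SGut_pentagon SGut_compl_pentagon /sum_upper binn.
  have -> : s1 5 2 2 = 2%N by [].
  ring.
- exists pentagon, 5%N, 5%N, 2%N, 2%N, 5%N; split; first exact: pentagon_params.
  rewrite SGut_pentagon SGut_compl_pentagon /prod_upper binn.
  by field.
Qed.
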